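(* Let $(H,\cdot,\circ)$ be a skew left brace and $(I,\cdot)$ a module over $(H,\cdot,\circ)$ with respect to the action $(\xi,\zeta,\epsilon)$, i.e. $I$ is an abelian group, viewed as a trivial brace, with a good triplet $(\xi,\zeta,\epsilon)$ of actions of $H$ on $I$. Then the map $$\Omega_{SB}:=\widetilde\Upsilon\,\Theta\,\Upsilon^{-1}:\ \mathrm{H}^2_{SB}(H,I)\to\mathrm{H}^2_{SB}(\widetilde H,\widetilde I)$$ is a homomorphism of groups.
   Context: **Skew braces and squares.** A skew left brace is $(H,\cdot,\circ)$ with $(H,\cdot)$, $(H,\circ)$ groups and $a\circ(b\cdot c)=(a\circ b)\cdot a^{-1}\cdot(a\circ c)$; $a^{-1}$, $a^\dagger$ are the inverses in $(H,\cdot)$, $(H,\circ)$; $\lambda^H_a(b)=a^{-1}\cdot(a\circ b)$. Homomorphisms preserve both operations. A trivial brace is an abelian group with both operations equal. The square of $(H,\cdot,\circ)$ is the skew left brace $(\widetilde H,\bullet,\odot)$ on $H\times H$ with $(h_1,g_1)\bullet(h_2,g_2)=(h_1\cdot\lambda^H_{g_1}(h_2),g_1\circ g_2)$ and $(h_1,g_1)\odot(h_2,g_2)=(h_1\circ h_2,h_1\circ g_2\circ h_1^\dagger\circ g_1)$; $\widetilde I=I\times I$ is again a trivial brace. **Good triplets and cohomology.** Let $(M,\cdot,\circ)$ be a skew left brace and $J$ an abelian group. A good triplet of actions of $M$ on $J$ is a homomorphism $\xi:(M,\circ)\to\mathrm{Aut}(J)$ and anti-homomorphisms $\zeta:(M,\cdot)\to\mathrm{Aut}(J)$,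 $\epsilon:(M,\circ)\to\mathrm{Aut}(J)$ with $\xi_{m_1\cdot m_2}(\epsilon_{m_1\cdot m_2}(y))\,\zeta_{m_2}(y)=\zeta_{m_2}(\xi_{m_1}(\epsilon_{m_1}(y)))\,\xi_{m_2}(\epsilon_{m_2}(y))$ and $\zeta_{m_1^{-1}\cdot(m_1\circ m_2)}(\xi_{m_1}(y))=\xi_{m_1}(\zeta_{m_2}(y))$. $\mathrm{Z}^2_{SB}(M,J)$ is the group (pointwise multiplication) of pairs $(g,f)$ of maps $M\times M\to J$, trivial when some argument is $1$, with - $g(m_2,m_3)\,g(m_1\cdot m_2,m_3)^{-1}g(m_1,m_2\cdot m_3)\,\zeta_{m_3}(g(m_1,m_2))^{-1}=1$, - $\xi_{m_1}(f(m_2,m_3))\,f(m_1\circ m_2,m_3)^{-1}f(m_1,m_2\circ m_3)\,\xi_{m_1\circ m_2\circ m_3}\big(\epsilon_{m_3}(\xi^{-1}_{m_1\circ m_2}(f(m_1,m_2)))\big)^{-1}=1$, - $\xi_{m_1}(g(m_2,m_3))\,\zeta_{m_1\circ m_3}(g(m_1,m_1^{-1}))\,\zeta_{m_1\circ m_3}(g(m_1\circ m_2,m_1^{-1}))^{-1}\,g((m_1\circ m_2)\cdot m_1^{-1},m_1\circ m_3)^{-1}\,\zeta_{m_1^{-1}\cdot(m_1\circ m_3)}(f(m_1,m_2))^{-1}\,f(m_1,m_2\cdot m_3)\,f(m_1,m_3)^{-1}=1$. $\mathrm{B}^2_{SB}(M,J)$ is the subgroup of those $(g,f)$ for which there is $\theta:M\to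 J$ with $\theta(1)=1$ and $g(m_1,m_2)=\theta(m_1\cdot m_2)^{-1}\zeta_{m_2}(\theta(m_1))\theta(m_2)$, $f(m_1,m_2)=\theta(m_1\circ m_2)^{-1}\xi_{m_1\circ m_2}(\epsilon_{m_2}(\xi_{m_1}^{-1}(\theta(m_1))))\,\xi_{m_1}(\theta(m_2))$. $\mathrm{H}^2_{SB}(M,J)=\mathrm{Z}^2_{SB}/\mathrm{B}^2_{SB}$. **Extensions.** An extension of $M$ by $J$ (trivial brace) is a short exact sequence $\mathbf 1\to J\to E\to M\to\mathbf 1$ of skew brace homomorphisms, up to isomorphism inducing the identity on $J$ and $M$. For a section $s$ with $s(1)=1$ its associated action is $\xi_m(y)=\lambda^E_{s(m)}(y)$, $\zeta_m(y)=s(m)^{-1}\cdot y\cdot s(m)$, $\epsilon_m(y)=s(m)^\dagger\circ y\circ s(m)$ (independent of $s$). $\mathrm{Ext}_{(\xi,\zeta,\epsilon)}(M,J)$ is the set of classes with this associated action. It is known that $\Upsilon:\mathrm{Ext}_{(\xi,\zeta,\epsilon)}(M,J)\to\mathrm{H}^2_{SB}(M,J)$, $\Upsilon([E])=[\tau_1,\tau_2]$, $\tau_1(m_1,m_2)=s(m_1\cdot m_2)^{-1}\cdot s(m_1)\cdot s(m_2)$, $\tau_2(m_1,m_2)=s(m_1\circ m_2)^{-1}\cdot(s(m_1)\circ s(m_2))$, is a well-defined bijection. **The maps in the claim.** $\Upsilon$ is this bijection for $(H,I)$ and $(\xi,\zeta,\epsilon)$; $\widetilde\Upsilon$ is this bijection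 for $(\widetilde H,\widetilde I)$ and the good triplet $\widetilde\xi_{(h,g)}(a,b)=(\xi_{g^\dagger\circ h}(a),\epsilon_{h^\dagger\circ g}(b))$, $\widetilde\zeta_{(h,g)}(a,b)=(\xi_g^{-1}(\zeta_h(a)\zeta_h(b^{-1})\xi_h(\epsilon_h(b))),\epsilon_g(b))$, $\widetilde\epsilon_{(h,g)}(a,b)=(\epsilon_h(a),\epsilon_h(a\,\epsilon_g^{-1}(a^{-1}b)))$, with respect to which $\mathrm{H}^2_{SB}(\widetilde H,\widetilde I)$ is taken. $\Theta:\mathrm{Ext}_{(\xi,\zeta,\epsilon)}(H,I)\to\mathrm{Ext}_{(\widetilde\xi,\widetilde\zeta,\widetilde\epsilon)}(\widetilde H,\widetilde I)$ sends the class of $\mathbf 1\to I\xrightarrow{i}E\xrightarrow{\pi}H\to\mathbf 1$ to the class of $\mathbf 1\to\widetilde I\xrightarrow{i\times i}\widetilde E\xrightarrow{\pi\times\pi}\widetilde H\to\mathbf 1$. *)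

(* Defs.v *)
From HB Require Import structures.
From mathcomp Require Import all_boot all_algebra.
From mathcomp Require Import boolp classical_sets functions.

Set Implicit Arguments.
Unset Strict Implicit.
Unset Printing Implicit Defensive.

Import GRing.Theory Quotient.
Local Open Scope ring_scope.

Declare Scope brace_scope.
Delimit Scope brace_scope with B.
Local Open Scope brace_scope.

(** The unit [cone] of [circ] is not assumed to be [1]: that it is follows from
    the brace identity (lemma [cone1]). *)

HB.mixin Record Group_isSkewBrace H of Group H := {
  circ : H -> H -> H;
  cone : H;
  cinv : H -> H;
  circA : associative circ;
  circ_cone_l : left_id cone circ;
  circ_cone_r : right_id cone circ;
  circV_l : left_inverse cone cinv circ;
  circV_r : right_inverse cone cinv circ;
  circM : forall a b c : H,
    circ a (b * c)%g = (circ a b * a^-1 * circ a c)%g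
}.

#[short(type="skewBraceType")]
HB.structure Definition SkewBrace := {H of Group_isSkewBrace H & Group H}.

Notation "a \oc b" := (circ a b) (at level 40, left associativity) : brace_scope.

Definition lambda (H : skewBraceType) (a b : H) : H := (a^-1 * (a \oc b))%g.

Definition brace_hom (H K : skewBraceType) (f : H -> K) : Prop :=
  {morph f : a b / (a * b)%g} /\ {morph f : a b / a \oc b}.

Section SkewBraceTheory.
Variable H : skewBraceType.
Implicit Types a b c : H.

Lemma cone1 : cone = 1%g :> H.
Proof.
have e := circM (cone : H) 1%g 1%g.
move: e; rewrite !circ_cone_l !mulg1 mul1g => e.
by apply/(can_inj invgK); rewrite -e invg1.
Qed.

Lemma circ1g a : 1%g \oc a = a. Proof. by rewrite -cone1 circ_cone_l. Qed.
Lemma circg1 a : a \oc 1%g = a. Proof. by rewrite -cone1 circ_cone_r. Qed.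
Lemma circVg a : cinv a \oc a = 1%g. Proof. by rewrite -cone1 circV_l. Qed.
Lemma circgV a : a \oc cinv a = 1%g. Proof. by rewrite -cone1 circV_r. Qed.
Lemma circKg a b : cinv a \oc (a \oc b) = b.
Proof. by rewrite circA circVg circ1g. Qed.
Lemma circVKg a b : a \oc (cinv a \oc b) = b.
Proof. by rewrite circA circgV circ1g. Qed.
Lemma circgK a b : b \oc a \oc cinv a = b.
Proof. by rewrite -circA circgV circg1. Qed.
Lemma circgVK a b : b \oc cinv a \oc a = b.
Proof. by rewrite -circA circVg circg1. Qed.
Lemma circI a : injective (circ a). Proof. exact: can_inj (circKg a). Qed.
Lemma circ_eq1 a b : a \oc b = 1%g -> cinv a = b.
Proof. by move=> e; rewrite -[RHS](circKg a) e circg1. Qed.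
Lemma cinvK a : cinv (cinv a) = a. Proof. by apply/circ_eq1/circVg. Qed.
Lemma cinv1 : cinv 1%g = 1%g :> H. Proof. exact/circ_eq1/circ1g. Qed.
Lemma cinvM a b : cinv (a \oc b) = cinv b \oc cinv a.
Proof. by apply/circ_eq1; rewrite circA circgK circgV. Qed.

Lemma circE a b : a \oc b = (a * lambda a b)%g.
Proof. by rewrite /lambda mulVKg. Qed.
Lemma lambdaM a b c : lambda a (b * c)%g = (lambda a b * lambda a c)%g.
Proof. by rewrite /lambda circM !mulgA. Qed.
Lemma lambda1 a : lambda a 1%g = 1%g.
Proof. by rewrite /lambda circg1 mulVg. Qed.
Lemma lambdaV a b : lambda a b^-1%g = ((lambda a b)^-1)%g.
Proof. by apply/esym/mulg1_eq; rewrite -lambdaM mulgV lambda1. Qed.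
Lemma lambda_circ a b c : lambda (a \oc b) c = lambda a (lambda b c).
Proof.
rewrite [lambda b c]/lambda lambdaM lambdaV /lambda.
by rewrite invgM invgK !mulgA mulgK circA.
Qed.
Lemma lambda1g a : lambda 1%g a = a.
Proof. by rewrite /lambda circ1g invg1 mul1g. Qed.
Lemma lambdaK a b : lambda (cinv a) (lambda a b) = b.
Proof. by rewrite -lambda_circ circVg lambda1g. Qed.
Lemma lambdaVK a b : lambda a (lambda (cinv a) b) = b.
Proof. by rewrite -lambda_circ circgV lambda1g. Qed.
Lemma mulgE a b : (a * b)%g = a \oc lambda (cinv a) b.
Proof. by rewrite circE lambdaVK. Qed.
End SkewBraceTheory.

Section Hom.
Variables (H K : skewBraceType) (f : H -> K).
Hypothesis fh : brace_hom f.
Lemma brace_homM a b : f (a * b)%g = (f a * f b)%g. Proof. exact: fh.1. Qed.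
Lemma brace_homC a b : f (a \oc b) = f a \oc f b. Proof. exact: fh.2. Qed.
Lemma brace_hom1 : f 1%g = 1%g.
Proof. by apply: (@mulgI _ (f 1%g)); rewrite -brace_homM !mulg1. Qed.
Lemma brace_homV a : f (a^-1)%g = ((f a)^-1)%g.
Proof. by apply/esym/mulg1_eq; rewrite -brace_homM mulgV brace_hom1. Qed.
Lemma brace_homCV a : f (cinv a) = cinv (f a).
Proof. by apply/esym/circ_eq1; rewrite -brace_homC circgV brace_hom1. Qed.
Lemma brace_hom_lambda a b : f (lambda a b) = lambda (f a) (f b).
Proof. by rewrite /lambda brace_homM brace_homV brace_homC. Qed.
End Hom.

(** Abelian groups [J] are additive throughout; [Algebra.to_multiplicative J] is
    the same group written multiplicatively, made into a trivial brace here. *)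
Section TrivialBrace.
Variable J : zmodType.
Fact triv_circM (a b c : Algebra.to_multiplicative J) :
  (a * (b * c) = a * b * a^-1 * (a * c))%g.
Proof. by rewrite !mulgA mulgVK. Qed.
HB.instance Definition _ := Group_isSkewBrace.Build (Algebra.to_multiplicative J)
  (@mulgA (Algebra.to_multiplicative J)) (@mul1g (Algebra.to_multiplicative J))
  (@mulg1 (Algebra.to_multiplicative J)) (@mulVg (Algebra.to_multiplicative J))
  (@mulgV (Algebra.to_multiplicative J)) triv_circM.
End TrivialBrace.

Definition square (H : Type) : Type := (H * H)%type.

Section Square.
Variable H : skewBraceType.
Implicit Types x y z : square H.
HB.instance Definition _ := Choice.copy (square H) (H * H)%type.

Definition sq_mul x y : square H := ((x.1 * lambda x.2 y.1)%g, x.2 \oc y.2).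
Definition sq_one : square H := (1%g, 1%g).
Definition sq_inv x : square H := (lambda (cinv x.2) (x.1^-1)%g, cinv x.2).
Definition sq_circ x y : square H :=
  (x.1 \oc y.1, x.1 \oc y.2 \oc cinv x.1 \oc x.2).
Definition sq_cinv x : square H :=
  (cinv x.1, cinv x.1 \oc cinv x.2 \oc x.1).

Fact sq_mulA : associative sq_mul.
Proof.
by move=> x y z; rewrite /sq_mul /= lambdaM lambda_circ mulgA circA.
Qed.
Fact sq_mul1 : left_id sq_one sq_mul.
Proof. by case=> a b; rewrite /sq_mul /= lambda1g mul1g circ1g. Qed.
Fact sq_mulr1 : right_id sq_one sq_mul.
Proof. by case=> a b; rewrite /sq_mul /= lambda1 mulg1 circg1. Qed.
Fact sq_mulV : left_inverse sq_one sq_inv sq_mul.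
Proof. by case=> a b; rewrite /sq_mul /= -lambdaM mulVg lambda1 circVg. Qed.
Fact sq_mulrV : right_inverse sq_one sq_inv sq_mul.
Proof. by case=> a b; rewrite /sq_mul /= lambdaVK mulgV circgV. Qed.
HB.instance Definition _ :=
  isGroup.Build (square H) sq_mulA sq_mul1 sq_mulr1 sq_mulV sq_mulrV.

Fact sq_circA : associative sq_circ.
Proof.
move=> x y z; rewrite /sq_circ /= circA; congr pair.
by rewrite cinvM !(circA, circgK, circgVK).
Qed.
Fact sq_circ1 : left_id sq_one sq_circ.
Proof. by case=> a b; rewrite /sq_circ /= !circ1g cinv1 !circg1. Qed.
Fact sq_circr1 : right_id sq_one sq_circ.
Proof. by case=> a b; rewrite /sq_circ /= !circg1 circgV circ1g. Qed.
Fact sq_circV : left_inverse sq_one sq_cinv sq_circ.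
Proof.
case=> a b; rewrite /sq_circ /= circVg cinvK; congr pair.
by rewrite !(circA, circgK, circVg).
Qed.
Fact sq_circrV : right_inverse sq_one sq_cinv sq_circ.
Proof.
case=> a b; rewrite /sq_circ /= circgV; congr pair.
by rewrite !(circA, circgV, circ1g, circgK, circVg).
Qed.

Lemma sq_lambdaE x y :
  sq_mul (sq_inv x) (sq_circ x y) =
    (lambda (cinv x.2 \oc x.1) y.1,
     cinv x.2 \oc x.1 \oc y.2 \oc cinv (cinv x.2 \oc x.1)).
Proof.
rewrite /sq_mul /sq_circ /=; congr pair.
  by rewrite lambda_circ -lambdaM.
by rewrite cinvM cinvK !circA.
Qed.

Fact sq_circM x y z :
  sq_circ x (y * z)%g = (sq_circ x y * x^-1 * sq_circ x z)%g.
Proof.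
suff e : (x^-1 * sq_circ x (y * z) =
   (x^-1 * sq_circ x y) * (x^-1 * sq_circ x z))%g.
  by apply: (@mulgI (square H) x^-1%g); rewrite e !mulgA.
rewrite -![(_ * _)%g in LHS]/(sq_mul _ _) -![(x^-1 * _)%g]/(sq_mul (sq_inv x) _).
rewrite !sq_lambdaE -![(_ * _)%g]/(sq_mul _ _) /sq_mul /=; move: (cinv x.2 \oc x.1) => c; congr pair.
  by rewrite lambdaM -!lambda_circ circgVK.
by rewrite !circA circgVK.
Qed.
HB.instance Definition _ := Group_isSkewBrace.Build (square H)
  sq_circA sq_circ1 sq_circr1 sq_circV sq_circrV sq_circM.
End Square.

(** Equalities in abelian groups are decided by comparing integer coefficients. *)

Module ZmodTac.
Inductive expr :=
  Var of nat | Zero | Add of expr & expr | Opp of expr.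
Fixpoint eval (J : zmodType) (env : seq J) (e : expr) : J :=
  match e with
  | Var i => nth 0 env i
  | Zero => 0
  | Add e1 e2 => eval env e1 + eval env e2
  | Opp e1 => - eval env e1
  end.
Fixpoint coef (e : expr) (i : nat) : int :=
  match e with
  | Var j => (i == j)%:Z
  | Zero => 0
  | Add e1 e2 => coef e1 i + coef e2 i
  | Opp e1 => - coef e1 i
  end.
Lemma evalE (J : zmodType) (env : seq J) e :
  eval env e = \sum_(i < size env) nth 0 env i *~ coef e i.
Proof.
elim: e => [j||e1 IH1 e2 IH2|e1 IH1] /=.
- have [lt_j|le_j] := ltnP j (size env); last first.
    rewrite nth_default // big1 // => i _.
    by rewrite ltn_eqF ?mulr0z // (leq_trans (ltn_ord i)).
  rewrite (bigD1 (Ordinal lt_j)) //= eqxx mulr1z big1 ?addr0 // => i.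
  by rewrite -val_eqE /= => /negPf->; rewrite mulr0z.
- by rewrite big1 // => i _; rewrite mulr0z.
- by rewrite IH1 IH2 -big_split; apply: eq_bigr => i _; rewrite mulrzDr.
- by rewrite IH1 -sumrN; apply: eq_bigr => i _; rewrite mulrNz.
Qed.
Lemma eval_eq (J : zmodType) (env : seq J) e1 e2 :
  all (fun i => coef e1 i == coef e2 i) (iota 0 (size env)) ->
  eval env e1 = eval env e2.
Proof.
move=> /allP h; rewrite !evalE; apply: eq_bigr => i _.
by have /h/eqP-> : val i \in iota 0 (size env) by rewrite mem_iota /=.
Qed.
(* Atoms are compared up to conversion: structure instances reached through
   different inheritance paths are not syntactically equal. *)
Ltac same x y :=
  match constr:(O) with
  | _ => let _ := constr:(erefl x : x = y) in constr:(true)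
  | _ => constr:(false)
  end.
Ltac find x env :=
  lazymatch env with
  | ?y :: ?env' => lazymatch same x y with
    | true => constr:(O)
    | false => let n := find x env' in constr:(S n)
    end
  end.
Ltac has x env :=
  lazymatch env with
  | ?y :: ?env' =>
    lazymatch same x y with true => constr:(true) | false => has x env' end
  | _ => constr:(false)
  end.
Ltac atoms e env :=
  lazymatch e with
  | ?a + ?b => let env' := atoms a env in atoms b env'
  | - ?a => atoms a env
  | 0 => env
  | _ => lazymatch has e env with true => env | false => constr:(e :: env) end
  end.
Ltac quote e env :=
  lazymatch e with
  | ?a + ?b => let a' := quote a env in let b' := quote b env in
               constr:(Add a' b')
  | - ?a => let a' := quote a env in constr:(Opp a')
  | 0 => constr:(Zero)
  | _ => let n := find e env in constr:(Var n)
  end.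
Ltac zmod :=
  lazymatch goal with
  | |- @eq ?T ?a ?b =>
    let env := atoms a (@nil T) in let env := atoms b env in
    let a' := quote a env in let b' := quote b env in
    apply: (@eval_eq _ env a' b'); vm_compute; reflexivity
  end.
End ZmodTac.
Ltac zmod := ZmodTac.zmod.

Record zaut (J : zmodType) := ZAut {
  zaut_fun :> J -> J;
  zaut_inv : J -> J;
  zautB : {morph zaut_fun : x y / x - y};
  zautK : cancel zaut_fun zaut_inv;
  zautVK : cancel zaut_inv zaut_fun
}.

Section Zaut.
Variables (J : zmodType) (f : zaut J).
HB.instance Definition _ := GRing.isZmodMorphism.Build J J (zaut_fun f) (zautB f).
Fact zautVB : zmod_morphism (zaut_inv f).
Proof. exact: can2_zmod_morphism (zautK f) (zautVK f). Qed.
HB.instance Definition _ := GRing.isZmodMorphism.Build J J (zaut_inv f) zautVB.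
Lemma zaut_inj : injective f. Proof. exact: can_inj (zautK f). Qed.
End Zaut.

Section Cohomology.
Variables (M : skewBraceType) (J : zmodType).

Record triplet := Triplet {
  xi : M -> zaut J;
  zeta : M -> zaut J;
  eps : M -> zaut J
}.

Implicit Types (t : triplet) (g f : M -> M -> J).

Record good_triplet t : Prop := GoodTriplet {
  good_xi : forall m1 m2 y, xi t (m1 \oc m2) y = xi t m1 (xi t m2 y);
  good_zeta : forall m1 m2 y, zeta t (m1 * m2)%g y = zeta t m2 (zeta t m1 y);
  good_eps : forall m1 m2 y, eps t (m1 \oc m2) y = eps t m2 (eps t m1 y);
  good_xi_eps : forall m1 m2 y,
    xi t (m1 * m2)%g (eps t (m1 * m2)%g y) + zeta t m2 y =
    zeta t m2 (xi t m1 (eps t m1 y)) + xi t m2 (eps t m2 y);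
  good_zeta_xi : forall m1 m2 y,
    zeta t (m1^-1 * (m1 \oc m2))%g (xi t m1 y) = xi t m1 (zeta t m2 y)
}.

Definition normalized g : Prop := forall m, g 1%g m = 0 /\ g m 1%g = 0.

Definition mul_cocycle t g : Prop := forall m1 m2 m3,
  g m2 m3 - g (m1 * m2)%g m3 + g m1 (m2 * m3)%g - zeta t m3 (g m1 m2) = 0.

Definition circ_cocycle t f : Prop := forall m1 m2 m3,
  xi t m1 (f m2 m3) - f (m1 \oc m2) m3 + f m1 (m2 \oc m3)
  - xi t (m1 \oc m2 \oc m3)
      (eps t m3 (zaut_inv (xi t (m1 \oc m2)) (f m1 m2))) = 0.

Definition compat_cocycle t g f : Prop := forall m1 m2 m3,
  xi t m1 (g m2 m3)
  + zeta t (m1 \oc m3) (g m1 m1^-1%g)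
  - zeta t (m1 \oc m3) (g (m1 \oc m2) m1^-1%g)
  - g ((m1 \oc m2) * m1^-1)%g (m1 \oc m3)
  - zeta t (m1^-1 * (m1 \oc m3))%g (f m1 m2)
  + f m1 (m2 * m3)%g
  - f m1 m3 = 0.

Definition cocycle t : set ((M -> M -> J) * (M -> M -> J)) :=
  [set z | (normalized z.1 /\ normalized z.2) /\
           [/\ mul_cocycle t z.1, circ_cocycle t z.2
             & compat_cocycle t z.1 z.2]].

Definition coboundary t : set ((M -> M -> J) * (M -> M -> J)) :=
  [set z | exists theta : M -> J, [/\ theta 1%g = 0,
    (forall m1 m2, z.1 m1 m2 =
       - theta (m1 * m2)%g + zeta t m2 (theta m1) + theta m2)
  & (forall m1 m2, z.2 m1 m2 =
       - theta (m1 \oc m2)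
       + xi t (m1 \oc m2) (eps t m2 (zaut_inv (xi t m1) (theta m1)))
       + xi t m1 (theta m2))]].

Section Groups.
Variable t : triplet.

Definition cocycle_pred : {pred (M -> M -> J) * (M -> M -> J)} :=
  [pred z | `[< cocycle t z >]].
Lemma cocycleP z : reflect (cocycle t z) (z \in cocycle_pred).
Proof. exact: asboolP. Qed.
Fact cocycle_zmod_closed : zmod_closed cocycle_pred.
Proof.
split.
  apply/cocycleP; split; first by split=> m; split.
  by split=> m1 m2 m3 /=; rewrite ?[_ 0]raddf0 /= !raddf0 /= ?addr0 ?subr0.
move=> z w /cocycleP[[n1 n2] [h1 h2 h3]].
move=> /cocycleP[[n1' n2'] [h1' h2' h3']]; apply/cocycleP; split.
  split=> m; split; rewrite /= !fctE.
  - by rewrite (n1 m).1 (n1' m).1 subr0.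
  - by rewrite (n1 m).2 (n1' m).2 subr0.
  - by rewrite (n2 m).1 (n2' m).1 subr0.
  - by rewrite (n2 m).2 (n2' m).2 subr0.
split=> m1 m2 m3 /=; rewrite !fctE !raddfB /=.
- by rewrite -[RHS]subr0 -{1}(h1 m1 m2 m3) -(h1' m1 m2 m3); zmod.
- by rewrite -[RHS]subr0 -{1}(h2 m1 m2 m3) -(h2' m1 m2 m3); zmod.
- by rewrite -[RHS]subr0 -{1}(h3 m1 m2 m3) -(h3' m1 m2 m3); zmod.
Qed.
HB.instance Definition _ :=
  GRing.isZmodClosed.Build _ cocycle_pred cocycle_zmod_closed.

Record Z2 := MkZ2 { Z2val :> (M -> M -> J) * (M -> M -> J);
                    _ : Z2val \in cocycle_pred }.
HB.instance Definition _ := [isSub for Z2val].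
HB.instance Definition _ := [Choice of Z2 by <:].
HB.instance Definition _ := [SubChoice_isSubZmodule of Z2 by <:].

Definition coboundary_pred : {pred Z2} := [pred z | `[< coboundary t (val z) >]].
Lemma coboundaryP z : reflect (coboundary t (val z)) (z \in coboundary_pred).
Proof. exact: asboolP. Qed.
Fact coboundary_zmod_closed : zmod_closed coboundary_pred.
Proof.
split.
  by apply/coboundaryP; exists (fun=> 0); split=> // m1 m2 /=;
    rewrite !raddf0 /= ?raddf0 ?addr0 ?oppr0.
move=> z w /coboundaryP[a [a0 a1 a2]] /coboundaryP[b [b0 b1 b2]].
apply/coboundaryP; exists (fun m => a m - b m); split=> [|m1 m2|m1 m2] /=.
- by rewrite a0 b0 subr0.
- by rewrite !fctE a1 b1 !raddfB /=; zmod.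
- by rewrite !fctE a2 b2 !raddfB /=; zmod.
Qed.
HB.instance Definition _ :=
  GRing.isZmodClosed.Build _ coboundary_pred coboundary_zmod_closed.

Definition H2 := {quot coboundary_pred}.
HB.instance Definition _ := GRing.Zmodule.on H2.
End Groups.
End Cohomology.

Section Extensions.
Variables (M : skewBraceType) (J : zmodType).

Record extension := Extension {
  ext_brace :> skewBraceType;
  ext_inj : Algebra.to_multiplicative J -> ext_brace;
  ext_proj : ext_brace -> M;
  ext_inj_hom : brace_hom ext_inj;
  ext_proj_hom : brace_hom ext_proj;
  ext_inj_injective : injective ext_inj;
  ext_exact : forall x, ext_proj x = 1%g <-> exists y, ext_inj y = x;
  ext_proj_surj : forall m, exists x, ext_proj x = m
}.

Definition ext_iso (E1 E2 : extension) : Prop :=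
  exists phi : E1 -> E2, [/\ brace_hom phi, bijective phi,
    (forall y, phi (ext_inj E1 y) = ext_inj E2 y)
  & (forall x, ext_proj (phi x) = ext_proj x)].

Definition is_section (E : extension) (s : M -> E) : Prop :=
  s 1%g = 1%g /\ forall m, ext_proj (s m) = m.

Definition action_along (t : triplet M J) (E : extension) (s : M -> E) : Prop :=
  forall m (y : J),
  [/\ lambda (s m) (ext_inj E y) = ext_inj E (xi t m y),
      ((s m)^-1 * ext_inj E y * s m)%g = ext_inj E (zeta t m y)
    & cinv (s m) \oc ext_inj E y \oc s m = ext_inj E (eps t m y)].

Definition has_action (t : triplet M J) (E : extension) : Prop :=
  exists2 s : M -> E, is_section s & action_along t s.

(** [Ext_(xi,zeta,eps)(M,J)]: its elements are the isomorphism classes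
    themselves, as predicates on extensions. *)
Record Ext (t : triplet M J) := MkExt {
  ext_set : extension -> Prop;
  _ : exists2 E, has_action t E & ext_set = ext_iso E
}.

Definition ext_class (t : triplet M J) (E : extension) (hE : has_action t E) :
    Ext t :=
  MkExt (ex_intro2 _ (fun E0 => ext_iso E = ext_iso E0) E hE erefl).

(** The inverse of [ext_inj], of arbitrary value outside its image. *)
Definition ext_coord (E : extension) (x : E) : J :=
  xget 0 [set y : J | ext_inj E y = x].

Definition tau1 (E : extension) (s : M -> E) (m1 m2 : M) : J :=
  ext_coord ((s (m1 * m2))^-1 * s m1 * s m2)%g.
Definition tau2 (E : extension) (s : M -> E) (m1 m2 : M) : J :=
  ext_coord ((s (m1 \oc m2))^-1 * (s m1 \oc s m2))%g.

Lemma section_exists (E : extension) : exists s : M -> E, is_section s.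
Proof.
have [s hs] : {s : M -> E & forall m, ext_proj (s m) = m}.
  by apply: (@choice _ _ (fun m x => ext_proj (x : E) = m)) => m; apply: ext_proj_surj.
exists (fun m => if m == 1%g then 1%g else s m); split; first by rewrite eqxx.
move=> m; case: eqP => [->|//]; exact: brace_hom1 (ext_proj_hom E).
Qed.

Lemma ext_injD (E : extension) (a b : J) :
  ext_inj E (a + b) = (ext_inj E a * ext_inj E b)%g.
Proof. exact: (ext_inj_hom E).1. Qed.
Lemma ext_injC (E : extension) (a b : J) :
  ext_inj E (a + b) = ext_inj E a \oc ext_inj E b.
Proof. exact: (ext_inj_hom E).2. Qed.
Lemma ext_inj0 (E : extension) : ext_inj E (0 : J) = 1%g.
Proof. exact: brace_hom1 (ext_inj_hom E). Qed.
Lemma ext_injN (E : extension) (a : J) : ext_inj E (- a) = ((ext_inj E a)^-1)%g.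
Proof. exact: (brace_homV (ext_inj_hom E)). Qed.
Lemma ext_injCN (E : extension) (a : J) : ext_inj E (- a) = cinv (ext_inj E a).
Proof. exact: (brace_homCV (ext_inj_hom E)). Qed.
Lemma ext_proj_inj (E : extension) (a : J) : ext_proj (ext_inj E a) = 1%g.
Proof. by apply/ext_exact; exists a. Qed.
Lemma ext_projM (E : extension) (x y : E) :
  ext_proj (x * y)%g = (ext_proj x * ext_proj y)%g.
Proof. exact: (ext_proj_hom E).1. Qed.
Lemma ext_projC (E : extension) (x y : E) :
  ext_proj (x \oc y) = ext_proj x \oc ext_proj y.
Proof. exact: (ext_proj_hom E).2. Qed.
Lemma ext_proj1 (E : extension) : ext_proj (1%g : E) = 1%g.
Proof. exact: brace_hom1 (ext_proj_hom E). Qed.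
Lemma ext_projV (E : extension) (x : E) : ext_proj (x^-1)%g = ((ext_proj x)^-1)%g.
Proof. exact: (brace_homV (ext_proj_hom E)). Qed.
Lemma ext_projCV (E : extension) (x : E) : ext_proj (cinv x) = cinv (ext_proj x).
Proof. exact: (brace_homCV (ext_proj_hom E)). Qed.
Lemma ext_lambda_inj (E : extension) (a b : J) :
  lambda (ext_inj E a) (ext_inj E b) = ext_inj E b.
Proof. by rewrite /lambda -ext_injC ext_injD mulKg. Qed.

Lemma ext_coordE (E : extension) (x : E) :
  ext_proj x = 1%g -> ext_inj E (ext_coord x) = x.
Proof.
move=> /ext_exact[y yE].
by rewrite /ext_coord; case: xgetP => [_ -> //|/(_ y)].
Qed.
Lemma ext_coordK (E : extension) (a : J) : ext_coord (ext_inj E a) = a.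
Proof. by apply: (@ext_inj_injective E); apply/ext_coordE/ext_proj_inj. Qed.

Lemma ext_iso_refl E : ext_iso E E.
Proof. by exists id; split=> //; exists id. Qed.
Lemma ext_iso_sym E1 E2 : ext_iso E1 E2 -> ext_iso E2 E1.
Proof.
case=> phi [[hM hC] [psi K VK] hi hp]; exists psi; split.
- split=> a b; apply: (can_inj K); first by rewrite hM !VK.
  by rewrite hC !VK.
- by exists phi.
- by move=> y; rewrite -hi K.
- by move=> x; rewrite -hp VK.
Qed.
Lemma ext_iso_trans E1 E2 E3 : ext_iso E1 E2 -> ext_iso E2 E3 -> ext_iso E1 E3.
Proof.
case=> f [[fM fC] fb fi fp] [g [[gM gC] gb gi gp]]; exists (g \o f); split.
- by split=> a b /=; rewrite ?fM ?gM ?fC ?gC.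
- exact: bij_comp.
- by move=> y /=; rewrite fi gi.
- by move=> x /=; rewrite gp fp.
Qed.

Lemma Ext_eq t (C D : Ext t) : ext_set C = ext_set D -> C = D.
Proof.
case: C D => [C hC] [D hD] /= e; rewrite e in hC *.
by congr MkExt; apply: Prop_irrelevance.
Qed.
Lemma ext_classP t E1 E2 (h1 : has_action t E1) (h2 : has_action t E2) :
  ext_class h1 = ext_class h2 <-> ext_iso E1 E2.
Proof.
split=> [/(congr1 (@ext_set t)) /= e|e].
  by by rewrite e; apply: ext_iso_refl.
apply: Ext_eq; apply/predeqP => E; split; apply: ext_iso_trans => //.
exact: ext_iso_sym.
Qed.

Lemma ExtP t (C : Ext t) :
  exists2 E, has_action t E & ext_set C = ext_iso E.
Proof. by case: C. Qed.
Definition rep t (C : Ext t) : extension := s2val (cid2 (ExtP C)).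
Lemma rep_action t (C : Ext t) : has_action t (rep C).
Proof. by rewrite /rep; case: cid2. Qed.
Lemma repK t (C : Ext t) : ext_class (rep_action C) = C.
Proof.
by apply: Ext_eq; rewrite /= /rep; case: cid2.
Qed.

Definition sect (E : extension) : M -> E := sval (cid (section_exists E)).
Lemma sectP (E : extension) : is_section (sect E).
Proof. by rewrite /sect; case: cid. Qed.
End Extensions.
Arguments ext_inj {M J}.

Section Action.
Variables (M : skewBraceType) (J : zmodType) (t : triplet M J).
Variable E : extension M J.
Hypothesis actE : has_action t E.
Implicit Types (x y : E) (a b : J).
Notation i := (ext_inj E).
Notation p := (@ext_proj _ _ E).

Lemma ext_conj_inj a b : ((i a)^-1 * i b * i a)%g = i b.
Proof. by rewrite -ext_injN -!ext_injD; congr (i _); zmod. Qed.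

Lemma section_decM (s : M -> E) x : is_section s -> exists a, x = (s (p x) * i a)%g.
Proof.
case=> _ hs; have /ext_exact[a aE] : p ((s (p x))^-1 * x)%g = 1%g.
  by rewrite ext_projM ext_projV hs mulVg.
by exists a; rewrite aE mulVKg.
Qed.

Lemma section_decC (s : M -> E) x : is_section s -> exists a, x = s (p x) \oc i a.
Proof.
case=> _ hs; have /ext_exact[a aE] : p (cinv (s (p x)) \oc x) = 1%g.
  by rewrite ext_projC ext_projCV hs circVg.
by exists a; rewrite aE circVKg.
Qed.

(** The associated action does not depend on the section. *)
Lemma actP x a :
  [/\ lambda x (i a) = i (xi t (p x) a),
      (x^-1 * i a * x)%g = i (zeta t (p x) a)
    & cinv x \oc i a \oc x = i (eps t (p x) a)].
Proof.
have [s hs act] := actE; have [a1 a2 a3] := act (p x) a; split.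
- have [b ->] := section_decC x hs; rewrite lambda_circ ext_lambda_inj.
  by rewrite a1 ext_projC ext_proj_inj circg1 hs.2.
- have [b ->] := section_decM x hs; rewrite invgM.
  transitivity ((i b)^-1 * ((s (p x))^-1 * i a * s (p x)) * i b)%g.
    by rewrite !mulgA.
  by rewrite a2 ext_conj_inj ext_projM ext_proj_inj mulg1 hs.2.
- have [b ->] := section_decC x hs; rewrite cinvM.
  transitivity (cinv (i b) \oc (cinv (s (p x)) \oc i a \oc s (p x)) \oc i b).
    by rewrite !circA.
  rewrite a3 ext_projC ext_proj_inj circg1 hs.2.
  by rewrite -ext_injCN -!ext_injC; congr (i _); zmod.
Qed.

Lemma act_section (s : M -> E) : is_section s -> action_along t s.
Proof. by move=> [_ hs] m a; have := actP (s m) a; rewrite hs. Qed.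

Lemma act_xi x a : x \oc i a = (x * i (xi t (p x) a))%g.
Proof. by rewrite circE; case: (actP x a) => ->. Qed.
Lemma act_zeta x a : (i a * x = x * i (zeta t (p x) a))%g.
Proof. by case: (actP x a) => _ <- _; rewrite !mulgA mulgV mul1g. Qed.
Lemma act_eps x a : i a \oc x = x \oc i (eps t (p x) a).
Proof. by case: (actP x a) => _ _ <-; rewrite !circA circgV circ1g. Qed.
Lemma act_mul x a : (x * i a)%g = x \oc i (zaut_inv (xi t (p x)) a).
Proof. by rewrite act_xi zautVK. Qed.

Lemma mul_inj_inj x : injective (fun a => (x * i a)%g).
Proof. by move=> a b /mulgI/ext_inj_injective. Qed.
Lemma circ_inj_inj x : injective (fun a => x \oc i a).
Proof. by move=> a b /circI/ext_inj_injective. Qed.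

Lemma action_good : good_triplet t.
Proof.
have surj m : exists x, p x = m by apply: ext_proj_surj.
have xiM m1 m2 (a : J) : xi t (m1 \oc m2) a = xi t m1 (xi t m2 a).
  have [x1 <-] := surj m1; have [x2 <-] := surj m2.
  apply: (@ext_inj_injective _ _ E).
  case: (actP (x1 \oc x2) a); rewrite ext_projC => <- _ _.
  rewrite lambda_circ; case: (actP x2 a) => -> _ _.
  by case: (actP x1 (xi t (p x2) a)) => -> _ _.
split=> // m1 m2 y; have [x1 <-] := surj m1; have [x2 <-] := surj m2.
- apply: (@mul_inj_inj (x1 * x2)%g); rewrite /= -ext_projM -act_zeta.
  by rewrite -mulgA -act_zeta !mulgA act_zeta.
- apply: (@circ_inj_inj (x1 \oc x2)); rewrite /= -ext_projC -act_eps.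
  by rewrite -circA -act_eps !circA act_eps.
- have e : (x1 * x2 * i (xi t (p x1 * p x2) (eps t (p x1 * p x2) y)) =
    x1 * x2 * i (zeta t (p x2) (xi t (p x1) (eps t (p x1) y) - y)
                 + xi t (p x2) (eps t (p x2) y)))%g.
    rewrite -ext_projM -act_xi -act_eps circM !act_eps !act_xi.
    transitivity (x1 * (i (xi t (p x1) (eps t (p x1) y) - y) * x2)
                  * i (xi t (p x2) (eps t (p x2) y)))%g.
      by rewrite ext_injD ext_injN !mulgA.
    by rewrite act_zeta ext_injD !mulgA.
  by move/mul_inj_inj: e => ->; rewrite raddfB /=; zmod.
- apply: (@ext_inj_injective _ _ E).
  have e : forall c, lambda x1 (i c) = i (xi t (p x1) c).
    by move=> c; case: (actP x1 c).
  rewrite -[in RHS]e; case: (actP x2 y) => _ <- _.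
  rewrite !lambdaM lambdaV e -ext_projC -ext_projV -ext_projM.
  by case: (actP (x1^-1 * (x1 \oc x2))%g (xi t (p x1) y)) => _ <- _.
Qed.

Section NormalForm.
Variable s : M -> E.
Hypothesis hs : is_section s.
Local Notation g := (tau1 s).
Local Notation f := (tau2 s).

Lemma tau1P m1 m2 : (s m1 * s m2 = s (m1 * m2)%g * i (g m1 m2))%g.
Proof.
rewrite ext_coordE ?mulgA ?mulgV ?mul1g //.
by rewrite !ext_projM ext_projV !hs.2 -mulgA mulVg.
Qed.
Lemma tau2P m1 m2 : s m1 \oc s m2 = (s (m1 \oc m2) * i (f m1 m2))%g.
Proof.
rewrite ext_coordE ?mulgA ?mulgV ?mul1g //.
by rewrite ext_projM ext_projC ext_projV !hs.2 mulVg.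
Qed.
Lemma nfM m1 m2 a b : ((s m1 * i a) * (s m2 * i b) =
  s (m1 * m2)%g * i (g m1 m2 + zeta t m2 a + b))%g.
Proof.
rewrite !ext_injD !mulgA -tau1P -[(s m1 * i a * s m2)%g]mulgA act_zeta.
by rewrite hs.2 !mulgA.
Qed.
Lemma nfC m1 m2 a b : ((s m1 * i a) \oc (s m2 * i b) =
  s (m1 \oc m2) * i (f m1 m2
    + xi t (m1 \oc m2) (eps t m2 (zaut_inv (xi t m1) a)) + xi t m1 b))%g.
Proof.
rewrite (act_mul (s m1) a) hs.2; set a' := zaut_inv _ _.
rewrite [in LHS]circE lambdaM mulgA -circE lambda_circ ext_lambda_inj.
case: (actP (s m1) b) => -> _ _; rewrite hs.2 -circA act_eps circA hs.2.
rewrite act_xi ext_projC !hs.2 tau2P.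
by rewrite !ext_injD !mulgA.
Qed.
Lemma nfI m1 m2 a b : (s m1 * i a = s m2 * i b)%g -> m1 = m2 /\ a = b.
Proof.
move=> e; have em : m1 = m2.
  by move/(congr1 p): e; rewrite !ext_projM !ext_proj_inj !hs.2 !mulg1.
by split=> //; move: e; rewrite em => /mul_inj_inj.
Qed.
Lemma nf0 m : s m = (s m * i 0)%g. Proof. by rewrite ext_inj0 mulg1. Qed.

Lemma tau_cocycle : cocycle t (g, f).
Proof.
have tg := action_good.
split.
  split=> m; split; apply: (@mul_inj_inj (s m)); rewrite /= ext_inj0 mulg1.
  - by have := tau1P 1%g m; rewrite mul1g hs.1 mul1g.
  - by have := tau1P m 1%g; rewrite mulg1 hs.1 mulg1.
  - by have := tau2P 1%g m; rewrite circ1g hs.1 circ1g.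
  - by have := tau2P m 1%g; rewrite circg1 hs.1 circg1.
split=> m1 m2 m3 /=.
- have := mulgA (s m1) (s m2) (s m3); rewrite (nf0 m1) (nf0 m2) (nf0 m3) !nfM.
  move=> /nfI[_]; rewrite !(raddf0, raddfD, addr0) /= => e.
  by rewrite -(subrr (g m1 (m2 * m3)%g + g m2 m3)) {2}e; zmod.
- have := circA (s m1) (s m2) (s m3); rewrite (nf0 m1) (nf0 m2) (nf0 m3) !nfC.
  move=> /nfI[_]; rewrite !(raddf0, raddfD, addr0) /= => e.
  by rewrite -(subrr (f m1 (m2 \oc m3) + xi t m1 (f m2 m3))) {2}e; zmod.
- have sV : ((s m1)^-1 = s (m1^-1) * i (- g m1 m1^-1))%g.
    apply/mulg1_eq; rewrite mulgA tau1P mulgV hs.1 mul1g -ext_injD subrr.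
    exact: ext_inj0.
  have := circM (s m1) (s m2) (s m3); rewrite sV (nf0 m1) (nf0 m2) (nf0 m3).
  rewrite !(nfM, nfC) => /nfI[_].
  rewrite !(good_zeta tg) !(raddf0, raddfD, raddfN, addr0) /= => e.
  by rewrite -(subrr (f m1 (m2 * m3)%g + xi t m1 (g m2 m3))) {2}e; zmod.
Qed.
End NormalForm.
End Action.

Section Upsilon.
Variables (M : skewBraceType) (J : zmodType) (t : triplet M J).

Definition tau (E : extension M J) (hE : has_action t E) (s : M -> E)
    (hs : is_section s) : Z2 t :=
  MkZ2 (introT (cocycleP t _) (tau_cocycle hE hs)).

Definition H2_class (z : Z2 t) : H2 t := \pi_(H2 t)%qT z.

Definition Upsilon (C : Ext t) : H2 t :=
  H2_class (tau (rep_action C) (sectP (rep C))).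

Lemma H2_classP z w :
  H2_class z = H2_class w <-> coboundary t (val (z - w)).
Proof.
split=> [/eqP|h]; first by rewrite /H2_class -Quotient.idealrBE => /coboundaryP.
by apply/eqP; rewrite /H2_class -Quotient.idealrBE; apply/coboundaryP.
Qed.

Lemma H2_classK (x : H2 t) : exists z, H2_class z = x.
Proof. by exists (repr x); rewrite /H2_class reprK. Qed.

Lemma tau_iso (E1 E2 : extension M J) (h1 : has_action t E1)
    (h2 : has_action t E2) (s1 : M -> E1) (s2 : M -> E2)
    (hs1 : is_section s1) (hs2 : is_section s2) :
  ext_iso E1 E2 <-> H2_class (tau h1 hs1) = H2_class (tau h2 hs2).
Proof.
rewrite H2_classP; split=> [[phi [[phiM phiC] _ phi_i phi_p]]|].
  pose theta m := ext_coord ((s2 m)^-1 * phi (s1 m))%g.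
  have thetaE m : phi (s1 m) = (s2 m * ext_inj E2 (theta m))%g.
    rewrite ext_coordE ?mulVKg // ext_projM ext_projV phi_p hs1.2 hs2.2.
    by rewrite mulVg.
  exists theta; split.
  - apply: (@ext_inj_injective _ _ E2); rewrite ext_inj0 ext_coordE.
      by rewrite hs1.1 hs2.1 invg1 mul1g -(ext_inj0 E1) phi_i ext_inj0.
    by rewrite ext_projM ext_projV phi_p hs1.1 hs2.1 !ext_proj1 invg1 mul1g.
  - move=> m1 m2 /=; have := congr1 phi (tau1P hs1 m1 m2).
    rewrite !phiM !thetaE phi_i -[RHS]mulgA -ext_injD (nfM h2 hs2).
    move=> /(nfI hs2)[_] e.
    transitivity (tau1 s1 m1 m2 - tau1 s2 m1 m2); first by [].
    by apply: (@addrI _ (theta (m1 * m2)%g)); rewrite addrA -e; zmod.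
  - move=> m1 m2 /=; have := congr1 phi (tau2P hs1 m1 m2).
    rewrite phiC phiM !thetaE phi_i -[RHS]mulgA -ext_injD (nfC h2 hs2).
    move=> /(nfI hs2)[_] e.
    transitivity (tau2 s1 m1 m2 - tau2 s2 m1 m2); first by [].
    by apply: (@addrI _ (theta (m1 \oc m2))); rewrite addrA -e; zmod.
case=> theta [theta0 th1 th2].
pose k1 (x : E1) := ext_coord ((s1 (ext_proj x))^-1 * x)%g.
pose k2 (x : E2) := ext_coord ((s2 (ext_proj x))^-1 * x)%g.
have k1K m a : k1 (s1 m * ext_inj E1 a)%g = a.
  by rewrite /k1 ext_projM ext_proj_inj mulg1 hs1.2 mulKg ext_coordK.
have k2K m a : k2 (s2 m * ext_inj E2 a)%g = a.
  by rewrite /k2 ext_projM ext_proj_inj mulg1 hs2.2 mulKg ext_coordK.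
pose phi x := (s2 (ext_proj x) * ext_inj E2 (theta (ext_proj x) + k1 x))%g.
pose psi x := (s1 (ext_proj x) * ext_inj E1 (- theta (ext_proj x) + k2 x))%g.
have phiE m a :
    phi (s1 m * ext_inj E1 a)%g = (s2 m * ext_inj E2 (theta m + a))%g.
  by rewrite /phi k1K ext_projM ext_proj_inj mulg1 hs1.2.
have psiE m a :
    psi (s2 m * ext_inj E2 a)%g = (s1 m * ext_inj E1 (- theta m + a))%g.
  by rewrite /psi k2K ext_projM ext_proj_inj mulg1 hs2.2.
exists phi; split.
- split=> x y.
    have [a ->] := section_decM x hs1; have [b ->] := section_decM y hs1.
    rewrite (nfM h1 hs1) !phiE (nfM h2 hs2); congr (_ * ext_inj E2 _)%g.
    have : tau1 s1 (ext_proj x) (ext_proj y) - tau1 s2 (ext_proj x) (ext_proj y)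
      = _ := th1 _ _.
    by move/(canRL (subrK _)) ->; rewrite raddfD /=; zmod.
  have [a ->] := section_decM x hs1; have [b ->] := section_decM y hs1.
  rewrite (nfC h1 hs1) !phiE (nfC h2 hs2); congr (_ * ext_inj E2 _)%g.
  have : tau2 s1 (ext_proj x) (ext_proj y) - tau2 s2 (ext_proj x) (ext_proj y)
    = _ := th2 _ _.
  by move/(canRL (subrK _)) ->; rewrite !raddfD /=; zmod.
- exists psi => x.
    by have [a ->] := section_decM x hs1; rewrite phiE psiE addKr.
  by have [a ->] := section_decM x hs2; rewrite psiE phiE addNKr.
- move=> y; have := phiE 1%g y.
  by rewrite hs1.1 hs2.1 !mul1g theta0 add0r.
- move=> x; have [a ->] := section_decM x hs1.
  by rewrite phiE !ext_projM !ext_proj_inj hs1.2 hs2.2.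
Qed.

Lemma UpsilonE (E : extension M J) (hE : has_action t E) (s : M -> E)
    (hs : is_section s) :
  Upsilon (ext_class hE) = H2_class (tau hE hs).
Proof.
by rewrite /Upsilon -tau_iso -(ext_classP (rep_action _) hE) repK.
Qed.

Lemma Upsilon_inj : injective Upsilon.
Proof.
move=> C D; rewrite /Upsilon -tau_iso -(ext_classP (rep_action C) (rep_action D)).
by rewrite !repK.
Qed.
End Upsilon.

Definition crossed (M : skewBraceType) (J : zmodType) (t : triplet M J)
  (tg : good_triplet t) (z : Z2 t) : Type := (M * J)%type.

Section Crossed.
Variables (M : skewBraceType) (J : zmodType) (t : triplet M J).
Variables (tg : good_triplet t) (z : Z2 t).
Notation X := (crossed tg z).
HB.instance Definition _ := Choice.copy X (M * J)%type.
Implicit Types x y w : X.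
Notation g := ((val z).1).
Notation f := ((val z).2).

Let z_cocycle : cocycle t (val z). Proof. exact/cocycleP/valP. Qed.
Let g1m m : g 1%g m = 0. Proof. exact: (z_cocycle.1.1 m).1. Qed.
Let gm1 m : g m 1%g = 0. Proof. exact: (z_cocycle.1.1 m).2. Qed.
Let f1m m : f 1%g m = 0. Proof. exact: (z_cocycle.1.2 m).1. Qed.
Let fm1 m : f m 1%g = 0. Proof. exact: (z_cocycle.1.2 m).2. Qed.
Let zeta1 a : zeta t 1%g a = a.
Proof. by apply: (@zaut_inj _ (zeta t 1%g)); rewrite -(good_zeta tg) mulg1. Qed.
Let xi1 a : xi t 1%g a = a.
Proof. by apply: (@zaut_inj _ (xi t 1%g)); rewrite -(good_xi tg) circg1. Qed.
Let eps1 a : eps t 1%g a = a.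
Proof. by apply: (@zaut_inj _ (eps t 1%g)); rewrite -(good_eps tg) circg1. Qed.
Let xi1V a : zaut_inv (xi t 1%g) a = a.
Proof. by rewrite -[X in zaut_inv _ X](xi1 a) zautK. Qed.
Let xiV m1 m2 a : zaut_inv (xi t (m1 \oc m2)) (xi t m1 a) = zaut_inv (xi t m2) a.
Proof. by rewrite -{1}(zautVK (xi t m2) a) -(good_xi tg) zautK. Qed.

Definition cr_mul x y : X := ((x.1 * y.1)%g, g x.1 y.1 + zeta t y.1 x.2 + y.2).
Definition cr_one : X := (1%g, 0).
Definition cr_inv x : X :=
  ((x.1^-1)%g, - g x.1 x.1^-1%g - zeta t x.1^-1%g x.2).
Definition cr_circ x y : X := (x.1 \oc y.1,
  f x.1 y.1 + xi t (x.1 \oc y.1) (eps t y.1 (zaut_inv (xi t x.1) x.2))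
  + xi t x.1 y.2).
Definition cr_cinv x : X := (cinv x.1,
  zaut_inv (xi t x.1) (- f x.1 (cinv x.1) -
     eps t (cinv x.1) (zaut_inv (xi t x.1) x.2))).

Lemma cr_gE m1 m2 m3 : g m1 (m2 * m3)%g =
  - g m2 m3 + g (m1 * m2)%g m3 + zeta t m3 (g m1 m2).
Proof.
have [_ [h _ _]] := z_cocycle; rewrite -[RHS]addr0 -(h m1 m2 m3); zmod.
Qed.
Lemma cr_fE m1 m2 m3 : f m1 (m2 \oc m3) =
  - xi t m1 (f m2 m3) + f (m1 \oc m2) m3
  + xi t (m1 \oc m2 \oc m3)
      (eps t m3 (zaut_inv (xi t (m1 \oc m2)) (f m1 m2))).
Proof.
have [_ [_ h _]] := z_cocycle; rewrite -[RHS]addr0 -(h m1 m2 m3); zmod.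
Qed.
Lemma cr_gfE m1 m2 m3 : f m1 (m2 * m3)%g =
  - xi t m1 (g m2 m3)
  - zeta t (m1 \oc m3) (g m1 m1^-1%g)
  + zeta t (m1 \oc m3) (g (m1 \oc m2) m1^-1%g)
  + g ((m1 \oc m2) * m1^-1)%g (m1 \oc m3)
  + zeta t (m1^-1 * (m1 \oc m3))%g (f m1 m2)
  + f m1 m3.
Proof.
have [_ [_ _ h]] := z_cocycle; rewrite -[RHS]addr0 -(h m1 m2 m3); zmod.
Qed.

Fact right_to_left (op : X -> X -> X) one inv : associative op ->
  left_id one op -> right_id one op -> right_inverse one inv op ->
  left_inverse one inv op.
Proof.
move=> opA op1 opr1 opV x.
by rewrite -[LHS]opr1 -(opV (inv x)) -opA [op x _]opA opV op1.
Qed.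

Fact cr_mulA : associative cr_mul.
Proof.
move=> x y w; rewrite /cr_mul /= mulgA; congr pair.
by rewrite cr_gE (good_zeta tg) !raddfD /=; zmod.
Qed.
Fact cr_mul1 : left_id cr_one cr_mul.
Proof.
by case=> m a; rewrite /cr_mul /= mul1g g1m raddf0 !add0r.
Qed.
Fact cr_mulr1 : right_id cr_one cr_mul.
Proof.
by case=> m a; rewrite /cr_mul /= mulg1 gm1 zeta1 addr0 add0r.
Qed.
Fact cr_mulrV : right_inverse cr_one cr_inv cr_mul.
Proof. by move=> x; rewrite /cr_mul /= mulgV; congr pair; zmod. Qed.
Fact cr_mulV : left_inverse cr_one cr_inv cr_mul.
Proof. exact: right_to_left cr_mulA cr_mul1 cr_mulr1 cr_mulrV. Qed.
HB.instance Definition _ :=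
  isGroup.Build X cr_mulA cr_mul1 cr_mulr1 cr_mulV cr_mulrV.

Fact cr_circA : associative cr_circ.
Proof.
move=> x y w; rewrite /cr_circ /= circA; congr pair.
rewrite cr_fE; do ![rewrite !raddfD /=]; rewrite zautK xiV (good_eps tg) !(good_xi tg).
by zmod.
Qed.
Fact cr_circ1 : left_id cr_one cr_circ.
Proof.
case=> m a; rewrite /cr_circ /= circ1g f1m xi1.
by do ![rewrite raddf0 /=]; rewrite !add0r.
Qed.
Fact cr_circr1 : right_id cr_one cr_circ.
Proof.
case=> m a; rewrite /cr_circ /= circg1 fm1 eps1 zautVK raddf0.
by rewrite addr0 add0r.
Qed.
Fact cr_circrV : right_inverse cr_one cr_cinv cr_circ.
Proof.
move=> x; rewrite /cr_circ /= circgV; congr pair.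
by rewrite xi1 zautVK; zmod.
Qed.
Fact cr_circV : left_inverse cr_one cr_cinv cr_circ.
Proof. exact: right_to_left cr_circA cr_circ1 cr_circr1 cr_circrV. Qed.
Fact cr_circM x y w :
  cr_circ x (y * w)%g = (cr_circ x y * x^-1 * cr_circ x w)%g.
Proof.
rewrite -![(_ * _)%g]/(cr_mul _ _) -[(x^-1)%g]/(cr_inv x) /cr_mul /cr_circ /=.
rewrite circM; congr pair.
case: x y w => m1 y1 [m2 y2] [m3 y3] /=.
rewrite -(zautVK (xi t m1) y1) zautK; set v := zaut_inv _ _.
rewrite cr_gfE !raddfD /= !raddfN /= -!(good_zeta tg).
rewrite !(good_zeta_xi tg) -circM !(good_xi tg) !(good_zeta_xi tg).
have := congr1 (xi t m1) (good_xi_eps tg m2 m3 v); rewrite !raddfD /=.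
move/(canRL (addrK _)) => ->.
by zmod.
Qed.
HB.instance Definition _ := Group_isSkewBrace.Build X
  cr_circA cr_circ1 cr_circr1 cr_circV cr_circrV cr_circM.

Definition cr_inj (a : Algebra.to_multiplicative J) : X := (1%g, a).
Definition cr_proj x : M := x.1.
Fact cr_inj_hom : brace_hom cr_inj.
Proof.
split=> a b.
  by congr pair => /=; rewrite ?mul1g // g1m zeta1 add0r.
by congr pair => /=; rewrite ?circ1g // f1m xi1 eps1 xi1V xi1 add0r.
Qed.
Fact cr_proj_hom : brace_hom cr_proj. Proof. by []. Qed.
Fact cr_inj_injective : injective cr_inj. Proof. by move=> a b []. Qed.
Fact cr_exact x : cr_proj x = 1%g <-> exists a, cr_inj a = x.
Proof.
split=> [e|[a <-]//]; exists x.2; by rewrite /cr_inj -e; case: x {e}.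
Qed.
Fact cr_surj m : exists x, cr_proj x = m. Proof. by exists (m, 0). Qed.

Definition cr_ext : extension M J :=
  Extension cr_inj_hom cr_proj_hom cr_inj_injective cr_exact cr_surj.

Definition cr_sect (m : M) : cr_ext := ((m, 0) : X).
Lemma cr_sectP : is_section cr_sect. Proof. by []. Qed.

Lemma cr_mulE m a : (cr_sect m * ext_inj cr_ext a)%g = ((m, a) : X).
Proof.
by congr pair => /=; rewrite ?mulg1 // gm1 zeta1 !add0r.
Qed.

Lemma cr_action : has_action t cr_ext.
Proof.
exists cr_sect => // m a.
have e1 : cr_sect m \oc ext_inj cr_ext a = ((m, xi t m a) : X).
  congr pair => /=; rewrite ?circg1 // fm1.
  by rewrite !raddf0 !add0r.
split.
- by rewrite /lambda e1 -cr_mulE mulKg.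
- apply: (@mulgI _ (cr_sect m)); rewrite cr_mulE !mulgA mulgV mul1g.
  by congr pair => /=; rewrite ?mul1g // g1m add0r addr0.
- apply: (@circI _ (cr_sect m)); rewrite !circA circgV circ1g.
  transitivity ((m, xi t m (eps t m a)) : X).
    by congr pair => /=; rewrite ?circ1g // f1m xi1V raddf0 add0r addr0.
  by congr pair => /=; rewrite ?circg1 // fm1 !raddf0 !add0r.
Qed.

Lemma cr_tau : tau cr_action cr_sectP = z.
Proof.
apply: val_inj => /=; rewrite [RHS]surjective_pairing; congr pair.
  apply/funext => m1; apply/funext => m2; rewrite /tau1 -mulgA.
  have -> : (cr_sect m1 * cr_sect m2 =
      cr_sect (m1 * m2) * ext_inj cr_ext (g m1 m2))%g.
    by rewrite cr_mulE; congr pair => /=; rewrite raddf0 !addr0.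
  by rewrite mulKg ext_coordK.
apply/funext => m1; apply/funext => m2; rewrite /tau2.
have -> : cr_sect m1 \oc cr_sect m2 =
    (cr_sect (m1 \oc m2) * ext_inj cr_ext (f m1 m2))%g.
  rewrite cr_mulE; congr pair => /=.
  by rewrite !raddf0 !addr0.
by rewrite mulKg ext_coordK.
Qed.
End Crossed.

Section UpsilonInv.
Variables (M : skewBraceType) (J : zmodType) (t : triplet M J).
Hypothesis tg : good_triplet t.

Lemma Upsilon_surj (x : H2 t) : exists C, Upsilon C = x.
Proof.
have [z <-] := H2_classK x; exists (ext_class (cr_action tg z)).
by rewrite (UpsilonE _ (cr_sectP tg z)) cr_tau.
Qed.

Definition Upsilon_inv (x : H2 t) : Ext t := sval (cid (Upsilon_surj x)).

Lemma Upsilon_invK : cancel Upsilon_inv (@Upsilon _ _ t).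
Proof. by move=> x; rewrite /Upsilon_inv; case: cid. Qed.
Lemma UpsilonK : cancel (@Upsilon _ _ t) Upsilon_inv.
Proof. by move=> C; apply: Upsilon_inj; rewrite Upsilon_invK. Qed.
Lemma Upsilon_bij : bijective (@Upsilon _ _ t).
Proof. exact: Bijective UpsilonK Upsilon_invK. Qed.
End UpsilonInv.

Section SquareTriplet.
Variables (H : skewBraceType) (I : zmodType) (t : triplet H I).
Implicit Types (x : square H) (u : (I * I)%type).

Definition sq_xi_fun x u : (I * I)%type :=
  (xi t (cinv x.2 \oc x.1) u.1, eps t (cinv x.1 \oc x.2) u.2).
Definition sq_xi_inv x u : (I * I)%type :=
  (zaut_inv (xi t (cinv x.2 \oc x.1)) u.1,
   zaut_inv (eps t (cinv x.1 \oc x.2)) u.2).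
Fact sq_xiB x : {morph sq_xi_fun x : u v / u - v}.
Proof. by move=> u v; rewrite /sq_xi_fun /= !raddfB. Qed.
Fact sq_xiK x : cancel (sq_xi_fun x) (sq_xi_inv x).
Proof. by case=> a b; rewrite /sq_xi_inv /= !zautK. Qed.
Fact sq_xiVK x : cancel (sq_xi_inv x) (sq_xi_fun x).
Proof. by case=> a b; rewrite /sq_xi_fun /= !zautVK. Qed.

Definition sq_zeta_fun x u : (I * I)%type :=
  (zaut_inv (xi t x.2)
     (zeta t x.1 u.1 + zeta t x.1 (- u.2) + xi t x.1 (eps t x.1 u.2)),
   eps t x.2 u.2).
Definition sq_zeta_inv x u : (I * I)%type :=
  let b := zaut_inv (eps t x.2) u.2 in
  (zaut_inv (zeta t x.1)
     (xi t x.2 u.1 - zeta t x.1 (- b) - xi t x.1 (eps t x.1 b)),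
   b).
Fact sq_zetaB x : {morph sq_zeta_fun x : u v / u - v}.
Proof.
move=> u v; congr pair; rewrite /= ?raddfB //=.
by rewrite -zautVB; congr (zaut_inv _ _); rewrite !(raddfN, raddfB) /=; zmod.
Qed.
Fact sq_zetaK x : cancel (sq_zeta_fun x) (sq_zeta_inv x).
Proof.
case=> a b; rewrite /sq_zeta_inv /= zautK zautVK; congr pair.
by rewrite -[RHS](zautK (zeta t x.1)); congr (zaut_inv _ _); zmod.
Qed.
Fact sq_zetaVK x : cancel (sq_zeta_inv x) (sq_zeta_fun x).
Proof.
case=> a b; rewrite /sq_zeta_fun /= !zautVK; congr pair.
by rewrite -[RHS](zautK (xi t x.2)); congr (zaut_inv _ _); zmod.
Qed.

Definition sq_eps_fun x u : (I * I)%type :=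
  (eps t x.1 u.1, eps t x.1 (u.1 + zaut_inv (eps t x.2) (- u.1 + u.2))).
Definition sq_eps_inv x u : (I * I)%type :=
  let a := zaut_inv (eps t x.1) u.1 in
  (a, a + eps t x.2 (zaut_inv (eps t x.1) u.2 - a)).
Fact sq_epsB x : {morph sq_eps_fun x : u v / u - v}.
Proof.
move=> u v; congr pair; rewrite /= ?raddfB //=.
rewrite -zautB; congr (eps t _ _).
have -> : - u.1 - - v.1 + (u.2 - v.2) = (- u.1 + u.2) - (- v.1 + v.2) by zmod.
by rewrite raddfB /=; zmod.
Qed.
Fact sq_epsK x : cancel (sq_eps_fun x) (sq_eps_inv x).
Proof.
case=> a b; rewrite /sq_eps_inv /= !zautK; congr pair.
have -> : a + zaut_inv (eps t x.2) (- a + b) - a = zaut_inv (eps t x.2) (- a + b).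
  by zmod.
by rewrite zautVK; zmod.
Qed.
Fact sq_epsVK x : cancel (sq_eps_inv x) (sq_eps_fun x).
Proof.
case=> a b; rewrite /sq_eps_fun /= !zautVK addKr zautK; congr pair.
by rewrite addrC subrK zautVK.
Qed.

Definition square_triplet : triplet (square H) (I * I)%type := {|
  xi x := ZAut (sq_xiB x) (sq_xiK x) (sq_xiVK x);
  zeta x := ZAut (sq_zetaB x) (sq_zetaK x) (sq_zetaVK x);
  eps x := ZAut (sq_epsB x) (sq_epsK x) (sq_epsVK x)
|}.
End SquareTriplet.

Section SquareExtension.
Variables (H : skewBraceType) (I : zmodType).
Implicit Type E : extension H I.

Section Maps.
Variable E : extension H I.

Definition sq_inj (u : Algebra.to_multiplicative (I * I)%type) : square E :=
  (ext_inj E u.1, ext_inj E u.2).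
Definition sq_proj (x : square E) : square H := (ext_proj x.1, ext_proj x.2).

Fact sq_inj_hom : brace_hom sq_inj.
Proof.
split=> u v.
  apply: (congr2 pair); last by rewrite -ext_injC.
  by rewrite /= ext_lambda_inj -ext_injD.
apply: (congr2 pair); first by rewrite /= -ext_injC.
by rewrite /= -ext_injCN -!ext_injC; congr (ext_inj E _); rewrite /=; zmod.
Qed.
Fact sq_proj_hom : brace_hom sq_proj.
Proof.
split=> x y; apply: (congr2 pair) => /=.
- by rewrite ext_projM (brace_hom_lambda (ext_proj_hom E)).
- by rewrite ext_projC.
- by rewrite ext_projC.
- by rewrite !ext_projC ext_projCV.
Qed.
Fact sq_inj_injective : injective sq_inj.
Proof.
by move=> [a b] [c d] [/ext_inj_injective -> /ext_inj_injective ->].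
Qed.
Fact sq_exact (x : square E) : sq_proj x = 1%g <-> exists u, sq_inj u = x.
Proof.
split=> [[e1 e2]|[u <-]]; last by rewrite /sq_proj !ext_proj_inj.
have /ext_exact[a a1] := e1; have /ext_exact[b b1] := e2.
by exists (a, b); rewrite /sq_inj /= a1 b1; case: x {e1 e2 a1 b1}.
Qed.
Fact sq_surj (m : square H) : exists x, sq_proj x = m.
Proof.
case: m => h k; have [x <-] := ext_proj_surj E h.
by have [y <-] := ext_proj_surj E k; exists (x, y).
Qed.

Definition square_ext : extension (square H) (I * I)%type :=
  Extension sq_inj_hom sq_proj_hom sq_inj_injective sq_exact sq_surj.
End Maps.

Lemma square_ext_iso E1 E2 :
  ext_iso E1 E2 -> ext_iso (square_ext E1) (square_ext E2).
Proof.
case=> phi [phi_hom [psi K VK] phi_i phi_p].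
pose pphi (x : square_ext E1) : square_ext E2 := (phi x.1, phi x.2).
exists pphi; split.
- split=> x y; apply: (congr2 pair) => /=.
  + by rewrite phi_hom.1 (brace_hom_lambda phi_hom).
  + by rewrite phi_hom.2.
  + by rewrite phi_hom.2.
  + by rewrite !phi_hom.2 (brace_homCV phi_hom).
- exists (fun x : square_ext E2 => ((psi x.1, psi x.2) : square E1)).
    by case=> a b; rewrite /pphi /= !K.
  by case=> a b; rewrite /pphi /= !VK.
- by move=> u; rewrite /pphi /= !phi_i.
- by move=> x; apply: (congr2 pair); rewrite /= phi_p.
Qed.

Variable t : triplet H I.

Lemma square_action E : has_action t E ->
  has_action (square_triplet t) (square_ext E).
Proof.
move=> actE; have tg := action_good actE.
have [s hs] := section_exists (square_ext E).
exists s => // m u; have := hs.2 m; case: (s m) => x y <- {m}.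
have pV (z : E) : cinv (ext_proj z) = ext_proj (cinv z) by rewrite ext_projCV.
split.
- rewrite [LHS](sq_lambdaE (x, y)) /=; apply: (congr2 pair) => /=.
    by case: (actP actE (cinv y \oc x) u.1) => -> _ _; rewrite pV -ext_projC.
  case: (actP actE (cinv x \oc y) u.2) => _ _ e.
  by rewrite pV -ext_projC -e !cinvM !cinvK !circA.
- apply: (congr2 pair) => /=; last first.
    by case: (actP actE y u.2) => _ _ <-.
  set a : I := u.1; set b : I := u.2.
  have xb : lambda (ext_inj E b) x =
      (ext_inj E (- b) * (x * ext_inj E (xi t (ext_proj x)
         (eps t (ext_proj x) b))))%g.
    by rewrite -(act_xi actE) -(act_eps actE) /lambda ext_injN.
  rewrite lambda_circ -!lambdaM xb; apply: (can_inj (lambdaK y)).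
  rewrite lambdaVK; set c := _ + xi t _ _.
  case: (actP actE y (zaut_inv (xi t (ext_proj y)) c)) => -> _ _.
  rewrite zautVK /c !ext_injD.
  case: (actP actE x a) => _ <- _; case: (actP actE x (- b)) => _ <- _.
  by rewrite !mulgA mulgK.
- apply: (congr2 pair) => /=; first by case: (actP actE x u.1) => _ _ <-.
  set a : I := u.1; set b : I := u.2; set d := zaut_inv _ _.
  case: (actP actE x (a + d)) => _ _ <-.
  have yd : y \oc ext_inj E (- a + b) = ext_inj E d \oc y.
    by rewrite (act_eps actE) zautVK.
  rewrite ext_injC !cinvM !cinvK -[in RHS](circgK y (ext_inj E a \oc _)).
  rewrite -(circA (ext_inj E a)) -yd ext_injC ext_injCN.
  by rewrite !(circA, circgK, circgVK).
Qed.

(** As every good triplet is the action of some extension, its square is good. *)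
Lemma square_good : good_triplet t -> good_triplet (square_triplet t).
Proof.
by move=> tg; apply: (action_good (square_action (cr_action tg 0))).
Qed.

Definition Theta (C : Ext t) : Ext (square_triplet t) :=
  ext_class (square_action (rep_action C)).

Lemma ThetaE E (hE : has_action t E) :
  Theta (ext_class hE) = ext_class (square_action hE).
Proof.
apply/ext_classP; apply: square_ext_iso.
by apply/(ext_classP (rep_action _) hE); rewrite repK.
Qed.
End SquareExtension.

Definition Omega_SB (H : skewBraceType) (I : zmodType) (t : triplet H I)
    (tg : good_triplet t) : H2 t -> H2 (square_triplet t) :=
  fun x => Upsilon (Theta (Upsilon_inv tg x)).

(* Main.v *)
Require Import Defs.
From mathcomp Require Import all_boot all_algebra.
From mathcomp Require Import boolp functions.

Set Implicit Arguments.
Unset Strict Implicit.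
Unset Printing Implicit Defensive.

Import GRing.Theory.
Local Open Scope ring_scope.
Local Open Scope brace_scope.

(** The idea is that of the Baer sum.  If [E1], [E2], [E3] are the crossed
    product extensions of cocycles [z], [w] and [z + w], then the map
    [((m, a), (m, b)) |-> (m, a + b)] is a homomorphism of skew braces from the
    fibre product of [E1] and [E2] over [H] to [E3].  The square of a skew brace
    is built from its operations, so this homomorphism can be applied to both
    components at once, and it relates the squares of [E1], [E2] and [E3] in the
    same way.  It restricts to addition on the kernels and carries the product
    of two compatible sections to a section; the factor sets [tau1] and [tau2]
    being words in values of a section, those of [square_ext E3] are the sums of
    those of [square_ext E1] and [square_ext E2] ([tau_add]).  Since [Omega_SB]
    sends the class of [z] to the class of the factor sets of the square of its
    crossed product ([Omega_SB_class]), it is additive.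

    The homomorphism is represented by its graph, a ternary relation compatible
    with the operations ([brace_rel]); no fibre product has to be formed. *)

Record brace_rel (A B C : skewBraceType) (R : A -> B -> C -> Prop) : Prop :=
  BraceRel {
    relM : forall a b c a' b' c', R a b c -> R a' b' c' ->
      R (a * a')%g (b * b')%g (c * c')%g;
    relV : forall a b c, R a b c -> R (a^-1)%g (b^-1)%g (c^-1)%g;
    relC : forall a b c a' b' c', R a b c -> R a' b' c' ->
      R (a \oc a') (b \oc b') (c \oc c');
    relCV : forall a b c, R a b c -> R (cinv a) (cinv b) (cinv c)
  }.

Section Square.
Variables (A B C : skewBraceType) (R : A -> B -> C -> Prop).
Hypothesis RR : brace_rel R.

Lemma rel_lambda a b c a' b' c' : R a b c -> R a' b' c' ->
  R (lambda a a') (lambda b b') (lambda c c').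
Proof. by move=> r r'; apply: (relM RR); [apply: relV | apply: relC]. Qed.

Definition square_rel (x : square A) (y : square B) (w : square C) : Prop :=
  R x.1 y.1 w.1 /\ R x.2 y.2 w.2.

(** Both operations of a square, and their inverses, are words in [*], [\oc],
    their inverses and [lambda]; compatibility therefore passes to components. *)
Lemma square_brace_rel : brace_rel square_rel.
Proof.
split=> [x y w x' y' w' [r1 r2] [r1' r2']|x y w [r1 r2]
        |x y w x' y' w' [r1 r2] [r1' r2']|x y w [r1 r2]]; split=> /=.
- by apply: (relM RR) => //; apply: rel_lambda.
- exact: (relC RR).
- by apply: rel_lambda; [apply: (relCV RR) | apply: (relV RR)].
- exact: (relCV RR).
- exact: (relC RR).
- by do ?[apply: (relC RR) | apply: (relCV RR)].
- exact: (relCV RR).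
- by do ?[apply: (relC RR) | apply: (relCV RR)].
Qed.
End Square.

Section FactorSets.
Variables (M : skewBraceType) (J : zmodType) (E1 E2 E3 : extension M J).
Variable R : E1 -> E2 -> E3 -> Prop.
Hypothesis RR : brace_rel R.
Hypothesis R_inj : forall a b c : J,
  R (ext_inj E1 a) (ext_inj E2 b) (ext_inj E3 c) -> c = a + b.
Variables (s1 : M -> E1) (s2 : M -> E2) (s3 : M -> E3).
Hypotheses (hs1 : is_section s1) (hs2 : is_section s2) (hs3 : is_section s3).
Hypothesis R_sect : forall m, R (s1 m) (s2 m) (s3 m).

Lemma coord_add x y w : ext_proj x = 1%g -> ext_proj y = 1%g ->
  ext_proj w = 1%g -> R x y w -> ext_coord w = ext_coord x + ext_coord y.
Proof. by move=> x1 y1 w1 r; apply: R_inj; rewrite !ext_coordE. Qed.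

(** Both factor sets are words in the values of the section that lie in the
    kernel, where [R] is addition. *)
Lemma tau_add m1 m2 :
  tau1 s3 m1 m2 = tau1 s1 m1 m2 + tau1 s2 m1 m2 /\
  tau2 s3 m1 m2 = tau2 s1 m1 m2 + tau2 s2 m1 m2.
Proof.
have p1 (E : extension M J) (s : M -> E) : is_section s ->
    ext_proj ((s (m1 * m2))^-1 * s m1 * s m2)%g = 1%g.
  by move=> [_ hs]; rewrite !ext_projM ext_projV !hs -mulgA mulVg.
have p2 (E : extension M J) (s : M -> E) : is_section s ->
    ext_proj ((s (m1 \oc m2))^-1 * (s m1 \oc s m2))%g = 1%g.
  by move=> [_ hs]; rewrite ext_projM ext_projC ext_projV !hs mulVg.
split; apply: coord_add; rewrite ?p1 ?p2 //; apply: (relM RR) => //.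
- by apply: (relM RR) => //; apply: (relV RR).
- exact: (relV RR).
- exact: (relC RR).
Qed.
End FactorSets.

Section CrossedSum.
Variables (M : skewBraceType) (J : zmodType) (t : triplet M J).
Variables (tg : good_triplet t) (z w : Z2 t).

(** The graph of the Baer sum map on the fibre product of the two crossed products. *)
Definition crossed_add (x : cr_ext tg z) (y : cr_ext tg w)
    (v : cr_ext tg (z + w)) : Prop :=
  exists m (a b : J), [/\ x = (m, a), y = (m, b) & v = (m, a + b)].

(** In a crossed product the [J]-component of a product or inverse is a sum of
    cocycle values and of images of the [J]-components of the arguments under
    automorphisms; it is thus additive in the cocycle and these components
    taken together. *)
Lemma crossed_add_rel : brace_rel crossed_add.
Proof.
split=> [x y v x' y' v' [m [a [b [-> -> ->]]]] [m' [a' [b' [-> -> ->]]]]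
        |x y v [m [a [b [-> -> ->]]]]
        |x y v x' y' v' [m [a [b [-> -> ->]]]] [m' [a' [b' [-> -> ->]]]]
        |x y v [m [a [b [-> -> ->]]]]]; do 3 eexists; split;
  try reflexivity; apply: (congr2 pair) => //=; rewrite !fctE;
  do ?[rewrite !raddfD /= | rewrite !raddfB /=]; zmod.
Qed.
End CrossedSum.

Section Omega.
Variables (H : skewBraceType) (I : zmodType) (t : triplet H I).
Hypothesis tg : good_triplet t.

Definition sq_cr_sect (z : Z2 t) (m : square H) : square_ext (cr_ext tg z) :=
  (cr_sect tg z m.1, cr_sect tg z m.2).

Lemma sq_cr_sectP z : is_section (sq_cr_sect z).
Proof. by split=> // -[]. Qed.

(** [Omega_SB] is defined through arbitrary representatives and sections; its
    three factors are independent of them, so the crossed product of [z] and its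
    obvious section may be used instead. *)
Lemma Omega_SB_class z : Omega_SB tg (H2_class z) =
  H2_class (tau (square_action (cr_action tg z)) (sq_cr_sectP z)).
Proof.
have -> : H2_class z = Upsilon (ext_class (cr_action tg z)).
  by rewrite (UpsilonE _ (cr_sectP tg z)) cr_tau.
by rewrite /Omega_SB UpsilonK ThetaE (UpsilonE _ (sq_cr_sectP z)).
Qed.

Lemma square_tau_add z w m1 m2 :
  tau1 (sq_cr_sect (z + w)) m1 m2 =
    tau1 (sq_cr_sect z) m1 m2 + tau1 (sq_cr_sect w) m1 m2 /\
  tau2 (sq_cr_sect (z + w)) m1 m2 =
    tau2 (sq_cr_sect z) m1 m2 + tau2 (sq_cr_sect w) m1 m2.
Proof.
apply: (@tau_add _ _ (square_ext _) (square_ext _) (square_ext _)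
  _ (square_brace_rel (crossed_add_rel tg z w)));
  [|exact: sq_cr_sectP|exact: sq_cr_sectP|exact: sq_cr_sectP|].
  move=> [a1 a2] [b1 b2] [c1 c2] [].
  case=> m [a [b [[_ ->] [_ ->] [_ ->]]]].
  by case=> m' [a' [b' [[_ ->] [_ ->] [_ ->]]]].
(* The obvious section of a crossed product has zero [I]-component. *)
move=> m; split; [exists m.1 | exists m.2]; exists 0, 0; split=> //;
  by rewrite addr0.
Qed.
End Omega.

Theorem proposition4p10 (H : skewBraceType) (I : zmodType) (t : triplet H I)
    (tg : good_triplet t) :
  {morph Omega_SB tg : x y / x + y}.
Proof.
move=> x y; have [z <-] := H2_classK x; have [w <-] := H2_classK y.
have classD (M : skewBraceType) (J : zmodType) (u : triplet M J) (a b : Z2 u) :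
    H2_class (a + b) = H2_class a + H2_class b by exact: raddfD.
rewrite -classD !Omega_SB_class -classD; congr H2_class; apply: val_inj.
by apply: (congr2 pair); apply/funext => m1; apply/funext => m2;
  case: (square_tau_add tg z w m1 m2).
Qed.
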